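(* Consider the numerical method $$\begin{pmatrix}x_{n+1}\\ y_{n+1}\end{pmatrix}=A\begin{pmatrix}x_n\\ y_n\end{pmatrix}+\alpha\, b\,\Delta W_n,\qquad A=\begin{pmatrix}a_{11}&a_{12}\\ a_{21}&a_{22}\end{pmatrix},\quad b=\begin{pmatrix}b_1\\ b_2\end{pmatrix},$$ with step-size $h>0$, approximating the linear stochastic oscillator (see context), and suppose (A1) $4\det(A)-(\mathrm{tr}(A))^2>0$; (A3) $0<\det(A)<1$. Then: (1) The method is non-symplectic, i.e. it does not satisfy $\mathrm dx_{n+1}\wedge\mathrm dy_{n+1}=\mathrm dx_n\wedge\mathrm dy_n$. (2) The discrete mean velocity $B_N=\frac{x_N}{Nh}$, $N\ge1$, satisfies a large deviations principle (as $N\to\infty$, with speed $N$) with the good rate function $$\tilde J^h(y)=\begin{cases}0,&y=0,\\ +\infty,&y\ne0.\end{cases}$$ (3) If (A1) and (A3) hold for all sufficiently small $h$, then the method does not asymptotically preserve the large deviations principle of the mean velocity $\{B_T\}_{T>0}$ of the exact solution, i.e. for every $y\ne0$, $$\lim_{h\to0}\tilde J^h_{mod}(y)\ne J(y),$$ where $\tilde J^h_{mod}(y)=\tilde J^h(y)/h$ and $J(y)=\frac{y^2}{\alpha^2}$ is the rate function of the large deviations principle of $\{B_T\}_{T>0}$.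
   Context: Let $\alpha>0$, $x_0,y_0\in\mathbb R$ and let $W$ be a one-dimensional standard Brownian motion on a complete filtered probability space. The linear stochastic oscillator is $\mathrm dX_t=Y_t\,\mathrm dt$, $\mathrm dY_t=-X_t\,\mathrm dt+\alpha\,\mathrm dW_t$, $(X_0,Y_0)=(x_0,y_0)$, and $B_T=X_T/T$; $\{B_T\}_{T>0}$ satisfies a large deviations principle as $T\to\infty$ (speed $T$) with good rate function $J(y)=y^2/\alpha^2$. Numerical method: for a step-size $h>0$, $t_n=nh$, $\Delta W_n=W_{t_{n+1}}-W_{t_n}$, started at $(x_0,y_0)$. The real matrix $A=A(h)$ and real vector $b=b(h)$ depend on the method and on the constant step-size $h$ (dependence suppressed in the notation), and throughout $b_1^2+b_2^2\ne0$. A family of real random variables $\{Z_N\}_{N\ge1}$ satisfies a large deviations principle with rate function $I$ (a lower semicontinuous function $\mathbb R\to[0,\infty]$; good if its level sets $\{I\le a\}$, $a\in[0,\infty)$, are compact) if $\liminf_{N\to\infty}\frac1N\log\mathbf P(Z_N\in U)\ge-\inf_UI$ for every open $U\subset\mathbb R$ and $\limsup_{N\to\infty}\frac1N\log\mathbf P(Z_N\in C)\le-\inf_CI$ for every closed $C\subset\mathbb R$. Conventions: $\log0=-\infty$, $\inf\emptyset=+\infty$, $(+\infty)/h=+\infty$. *)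

(* Defs.v *)
From HB Require Import structures.
From mathcomp Require Import all_boot all_order all_algebra.
From mathcomp Require Import all_classical all_reals all_analysis.

Set Implicit Arguments.
Unset Strict Implicit.
Unset Printing Implicit Defensive.

Import Order.TTheory GRing.Theory Num.Theory.
Import numFieldNormedType.Exports.

Local Open Scope classical_set_scope.
Local Open Scope ring_scope.

(* Time ranges over [R]; all conditions on processes concern times [0 <= t]
   only, and values at negative times are irrelevant. *)

Definition complete_filtration d (Omega : measurableType d) (R : realType)
    (P : probability Omega R) (F : R -> set (set Omega)) : Prop :=
  [/\ forall t, 0 <= t -> sigma_algebra [set: Omega] (F t),
      forall t, 0 <= t -> F t `<=` measurable,
      forall s t, 0 <= s -> s <= t -> F s `<=` F t
    & forall N, P.-negligible N -> F 0 N].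

Definition adapted d (Omega : measurableType d) (R : realType)
    (F : R -> set (set Omega)) (X : R -> Omega -> R) : Prop :=
  forall t, 0 <= t -> forall B : set R, measurable B -> F t (X t @^-1` B).

(* The second parameter of [normal_prob] is the standard deviation. *)
Definition brownian_motion d (Omega : measurableType d) (R : realType)
    (P : probability Omega R) (F : R -> set (set Omega))
    (W : R -> Omega -> R) : Prop :=
  [/\ adapted F W,
      {ae P, forall w, W 0 w = 0},
      {ae P, forall w, {within `[0, +oo[, continuous (W ^~ w)}},
      forall s t, 0 <= s -> s < t -> forall B : set R, measurable B ->
        P ((fun w => W t w - W s w) @^-1` B) =
        normal_prob 0 (Num.sqrt (t - s)) B
    & forall s t, 0 <= s -> s < t -> forall (G : set Omega) (B : set R),
        F s G -> measurable B ->
        P (G `&` (fun w => W t w - W s w) @^-1` B) =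
        (P G * P ((fun w => (W t w - W s w)%R) @^-1` B))%E].

(* dX = Y dt, dY = - X dt + alpha dW in integrated form. The noise is additive,
   so the stochastic integral over [0, t] is [alpha * (W t - W 0)]. *)
Definition oscillator_solution d (Omega : measurableType d) (R : realType)
    (P : probability Omega R) (F : R -> set (set Omega)) (W : R -> Omega -> R)
    (alpha x0 y0 : R) (X Y : R -> Omega -> R) : Prop :=
  [/\ adapted F X, adapted F Y,
      {ae P, forall w, {within `[0, +oo[, continuous (X ^~ w)} /\
                       {within `[0, +oo[, continuous (Y ^~ w)}}
    & {ae P, forall w, forall t, 0 <= t ->
        X t w = x0 + \int[lebesgue_measure]_(s in `[0, t]) Y s w /\
        Y t w = y0 - \int[lebesgue_measure]_(s in `[0, t]) X s w
                + alpha * (W t w - W 0 w)}].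

Definition mean_velocity (R : realType) (Omega : Type) (X : R -> Omega -> R) :
    R -> Omega -> R :=
  fun T w => X T w / T.

(* State (x_n, y_n) of the method with matrix [A] and vector [b] started at
   [z], as a function of [z]. *)
Fixpoint numerical_solution (R : realType) (Omega : Type)
    (W : R -> Omega -> R) (alpha : R) (A : 'M[R]_2) (b : 'cV[R]_2) (h : R)
    (n : nat) (w : Omega) (z : 'cV[R]_2) : 'cV[R]_2 :=
  if n is m.+1 then
    A *m numerical_solution W alpha A b h m w z
      + (alpha * (W (m.+1%:R * h) w - W (m%:R * h) w)) *: b
  else z.

Definition initial_state (R : realType) (x0 y0 : R) : 'cV[R]_2 :=
  \col_i (if i == 0 then x0 else y0).

Definition discrete_mean_velocity (R : realType) (Omega : Type)
    (W : R -> Omega -> R) (alpha x0 y0 : R) (A : 'M[R]_2) (b : 'cV[R]_2)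
    (h : R) : nat -> Omega -> R :=
  fun N w =>
    numerical_solution W alpha A b h N w (initial_state x0 y0) 0 0 / (N%:R * h).

(* The 2-form df /\ dg at the point [p], evaluated on the pair [(u, v)]. *)
Definition wedge (R : realType) (f g : 'cV[R]_2 -> R) (p u v : 'cV[R]_2) : R :=
  'd f p u * 'd g p v - 'd f p v * 'd g p u.

(* [x_n] and [y_n] are differentiated with respect to the initial data; the
   equality of 2-forms is required almost surely. *)
Definition symplectic_method d (Omega : measurableType d) (R : realType)
    (P : probability Omega R) (W : R -> Omega -> R) (alpha : R)
    (A : 'M[R]_2) (b : 'cV[R]_2) (h : R) : Prop :=
  let x n w z := numerical_solution W alpha A b h n w z 0 0 in
  let y n w z := numerical_solution W alpha A b h n w z 1 0 in
  forall n, {ae P, forall w, forall p u v : 'cV[R]_2,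
    wedge (x n.+1 w) (y n.+1 w) p u v = wedge (x n w) (y n w) p u v}.

Definition rate_function (R : realType) (J : R -> \bar R) : Prop :=
  (forall y, (0 <= J y)%E) /\ lower_semicontinuous J.

Definition good_rate_function (R : realType) (J : R -> \bar R) : Prop :=
  rate_function J /\
  forall a : R, 0 <= a -> compact [set y | (J y <= a%:E)%E].

(* Large deviations principle for random variables [Z i], [i] in [D], along the
   filter [L] with the given speed. *)
Definition ldp d (Omega : measurableType d) (R : realType)
    (P : probability Omega R) (I : topologicalType) (D : set I) (L : set_system I)
    (speed : I -> R) (Z : I -> Omega -> R) (J : R -> \bar R) : Prop :=
  let rate B i := ((speed i)^-1%:E * lne (P (Z i @^-1` B)))%E in
  [/\ forall i, D i -> measurable_fun [set: Omega] (Z i),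
      rate_function J,
      forall U : set R, open U ->
        (- ereal_inf (J @` U) <= limf_einf (rate U) L)%E
    & forall C : set R, closed C ->
        (limf_esup (rate C) L <= - ereal_inf (J @` C))%E].

Definition discrete_ldp d (Omega : measurableType d) (R : realType)
    (P : probability Omega R) (Z : nat -> Omega -> R) (J : R -> \bar R) : Prop :=
  ldp P [set N | (0 < N)%N] \oo (fun N => N%:R) Z J.

Definition continuous_ldp d (Omega : measurableType d) (R : realType)
    (P : probability Omega R) (Z : R -> Omega -> R) (J : R -> \bar R) : Prop :=
  ldp P [set T : R | 0 < T] (+oo : set_system R) id Z J.

Definition degenerate_rate (R : realType) (y : R) : \bar R :=
  if y == 0 then 0%E else +oo%E.

Definition oscillator_rate (R : realType) (alpha y : R) : \bar R :=
  (y ^+ 2 / alpha ^+ 2)%:E.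

Definition modified_rate (R : realType) (h : R) (J : R -> \bar R) (y : R) :
    \bar R :=
  (J y * h^-1%:E)%E.

(* [B] is a process in continuous time and [Bh h] its discretization with
   step-size [h]. Rate functions are unique, hence the existential form. *)
Definition asymptotically_preserves_ldp d (Omega : measurableType d)
    (R : realType) (P : probability Omega R) (B : R -> Omega -> R)
    (Bh : R -> nat -> Omega -> R) : Prop :=
  exists (J : R -> \bar R) (Jh : R -> R -> \bar R),
    [/\ continuous_ldp P B J,
        \forall h \near 0^'+, discrete_ldp P (Bh h) (Jh h)
      & forall y, modified_rate h (Jh h) y @[h --> 0^'+] --> J y].

(* Main.v *)
(* The quadratic form [Q z = det (z, A z)] satisfies [Q (A z) = det A * Q z],
   and by (A1) it is definite. Under (A3) it is therefore a Lyapunov function: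
   if the first [N] Brownian increments are bounded by [M], then
   [x_N ^ 2 <= K (1 + M ^ 2)] with [K] independent of [N]. Hence
   [|x_N| >= e N h] forces one of [N] Gaussian increments to exceed [c N], which
   by a union bound has probability at most [2 N exp (- c ^ 2 N ^ 2 / (2 h))].
   This decays faster than every [exp (- K N)], so the rate function is [+oo]
   off the origin. The step map multiplies the area form by [det A], so the
   method is not symplectic. *)

Require Import Defs.
From HB Require Import structures.
From mathcomp Require Import all_boot all_order all_algebra.
From mathcomp Require Import all_classical all_reals all_analysis.
From mathcomp Require Import measurable_realfun ring lra.
Import Order.TTheory GRing.Theory Num.Theory.
Import numFieldNormedType.Exports.
Local Open Scope classical_set_scope.
Local Open Scope ring_scope.

Set Implicit Arguments.
Unset Strict Implicit.

(** * Limits along filters and uniqueness of rate functions *)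

Lemma limf_esup_le (R : realType) (I : topologicalType) (L : set_system I)
    (f : I -> \bar R) (c : \bar R) :
  (\forall i \near L, (f i <= c)%E) -> (limf_esup f L <= c)%E.
Proof.
move=> fc; apply: ge_ereal_inf.
exists (ereal_sup (f @` [set i | (f i <= c)%E])).
  by exists [set i | (f i <= c)%E].
by apply: ge_ereal_sup => _ [i fi <-].
Qed.

Lemma limf_einf_ge (R : realType) (I : topologicalType) (L : set_system I)
    {FL : Filter L} (f : I -> \bar R) (c : \bar R) :
  (\forall i \near L, (c <= f i)%E) -> (c <= limf_einf f L)%E.
Proof.
move=> cf; rewrite /limf_einf leeNr; apply: limf_esup_le.
by apply: (@filterS _ L _ _ _ _ cf) => i /=; rewrite leeN2.
Qed.

(** In a proper filter, a set witnessing the lower limit, one witnessing the upper limit and the set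
    where [f <= g] have a common point. This links the lower bound on an open set to the upper bound
    on a closed superset. *)
Lemma limf_einf_le_esup (R : realType) (I : topologicalType) (L : set_system I)
    {FL : ProperFilter L} (f g : I -> \bar R) :
  (\forall i \near L, (f i <= g i)%E) -> (limf_einf f L <= limf_esup g L)%E.
Proof.
move=> fg; rewrite limf_einfE limf_esupE.
apply: ge_ereal_sup => _ [A LA <-]; apply: le_ereal_inf_tmp => _ [B LB <-].
have [i [[Ai Bi] /= fgi]] := filter_ex (@filterI _ L _ _ _ (filterI LA LB) fg).
apply: (@le_trans _ _ (f i)); first by apply: ereal_inf_lbound; exists i.
by apply: (le_trans fgi); apply: ereal_sup_ubound; exists i.
Qed.

(* The lower bound for [J'] on an open ball around [y] is at most the upper
   bound [-oo] that [J] gives on the closed ball. *)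
Lemma ldp_rate_pinfty d (Omega : measurableType d) (R : realType)
    (P : probability Omega R) (I : topologicalType) (D : set I)
    (L : set_system I) {FL : ProperFilter L} (speed : I -> R)
    (Z : I -> Omega -> R) (J J' : R -> \bar R) (y e : R) :
  (\forall i \near L, D i /\ 0 <= speed i) ->
  ldp P D L speed Z J -> ldp P D L speed Z J' ->
  0 < e -> (forall z, `|y - z| <= e -> J z = +oo%E) -> J' y = +oo%E.
Proof.
move=> LD [mZ _ _ ubJ] [_ _ lbJ' _] e0 Jy.
have /= lb := lbJ' _ (ball_open y e).
have /= ub := ubJ _ (@closed_ball_closed _ _ y e).
have infJ : ereal_inf (J @` closed_ball y e) = +oo%E.
  apply/eqP; rewrite -leye_eq; apply: le_ereal_inf_tmp => _ [z + <-].
  by rewrite closed_ballE// => /Jy ->.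
rewrite infJ /= in ub.
have {lb ub} : (- ereal_inf (J' @` ball y e) <= -oo)%E.
  apply: (le_trans lb); apply: le_trans ub.
  apply: limf_einf_le_esup; apply: (@filterS _ L _ _ _ _ LD) => i [Di si].
  have ballS := @subset_closed_ball _ _ y e.
  have mB (B : set R) : measurable B -> measurable (Z i @^-1` B).
    by move=> mB; rewrite -[X in measurable X]setTI; exact: mZ.
  apply: lee_wpmul2l; first by rewrite lee_fin invr_ge0.
  rewrite lee_lne ?in_itv/= ?leey ?andbT ?measure_ge0//.
  apply: le_measure; rewrite ?inE.
  - by apply: mB; exact: measurable_ball.
  - by apply: mB; exact: measurable_closed_ball.
  - by move=> w /ballS.
rewrite leeNl /= => inf_y.
apply/eqP; rewrite -leye_eq; apply: (le_trans inf_y).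
by apply: ereal_inf_lbound; exists y => //; exact: ballxx.
Qed.

(** * The degenerate large deviations principle *)

Lemma good_degenerate_rate (R : realType) :
  good_rate_function (@degenerate_rate R).
Proof.
split.
  split=> [y|x a]; rewrite /degenerate_rate.
    by case: ifP => // _; rewrite leey.
  case: eqVneq => [_ a0|x0 _].
    exists setT; first exact: filterT.
    by move=> y _; case: ifP => // _; rewrite ltry.
  exists [set y | y != 0].
    by apply: open_nbhs_nbhs; split => //; exact: open_neq.
  by move=> y /negbTE ->; rewrite ltry.
move=> a a0.
rewrite (_ : [set y | _] = [set 0]); first exact: compact_set1.
apply/seteqP; split => y /=; rewrite /degenerate_rate.
  by case: eqVneq => // _; rewrite leye_eq.
by move=> ->; rewrite eqxx lee_fin.
Qed.

Lemma measurable_normr_ge (R : realType) d (T : measurableType d) (f : T -> R)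
    (e : R) :
  measurable_fun [set: T] f -> measurable [set x | (e <= `|f x|)%R].
Proof.
move=> mf; have mnf : measurable_fun [set: T] (fun x => `|f x|).
  exact: measurableT_comp.
rewrite (_ : [set x | _] = [set: T] `&` (fun x => `|f x|) @^-1` `[e, +oo[).
  exact: mnf.
by rewrite setTI; apply/seteqP; split => x /=; rewrite in_itv/= andbT.
Qed.

(** Tails below every exponential send all closed sets missing 0 to [-oo], while an open set around
    0 eventually has probability at least 1/2, which is invisible at speed [N]. *)
Lemma discrete_ldp_degenerate d (Omega : measurableType d) (R : realType)
    (P : probability Omega R) (Z : nat -> Omega -> R) :
  (forall N, (0 < N)%N -> measurable_fun [set: Omega] (Z N)) ->
  (forall e K : R, 0 < e -> \forall N \near \oo,
    (P [set w | (e <= `|Z N w|)%R] <= (expR (- (K * N%:R)))%:E)%E) ->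
  discrete_ldp P Z (@degenerate_rate R).
Proof.
move=> mZ tailZ.
have mZB N B : (0 < N)%N -> measurable B -> measurable (Z N @^-1` B).
  by move=> N0 mB; rewrite -[X in measurable X]setTI; exact: mZ.
have mtail N (e : R) : (0 < N)%N -> measurable [set w | (e <= `|Z N w|)%R].
  by move=> N0; apply: measurable_normr_ge; exact: mZ.
have infy (B : set R) : ~ B 0 -> ereal_inf (@degenerate_rate R @` B) = +oo%E.
  move=> B0; apply/eqP; rewrite -leye_eq.
  apply: le_ereal_inf_tmp => _ [y By <-].
  by rewrite /degenerate_rate; case: eqVneq => // y0; rewrite y0 in By.
split => //; first exact: (good_degenerate_rate R).1.
- move=> U oU; have [U0|/infy ->] := pselect (U 0); last by rewrite leNye.
  apply: (@le_trans _ _ 0%E).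
    rewrite leeNl oppe0; apply: le_ereal_inf_tmp => _ [y _ <-].
    exact: (good_degenerate_rate R).1.1.
  (* It suffices to bound the lower limit below by [- e]: since ln(1/2) is a constant, ln(1/2) / [N]
     exceeds [- e] for large [N]. *)
  apply/lee_subgt0Pr => e e0; rewrite sub0e; apply: limf_einf_ge.
  have [r /= r0 rU] : nbhs_ball (0 : R) U.
    by apply/nbhs_ballP; exact: open_nbhs_nbhs.
  near=> N.
  have N0 : (0 < N)%N by near: N; exact: nbhs_infty_gt.
  have N0R : 0 < N%:R :> R by rewrite ltr0n.
  have PU : ((2^-1)%:E <= P (Z N @^-1` U))%E.
    have : (1 <= P (Z N @^-1` U) + P [set w | (r <= `|Z N w|)%R])%E.
      rewrite -(@probability_setT _ _ _ P).
      apply: le_trans (measureU2 _ _ _); last 2 first.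
      - by apply: mZB => //; exact: open_measurable.
      - exact: mtail.
      apply: le_measure; rewrite ?inE//.
        apply: measurableU; last exact: mtail.
        by apply: mZB => //; exact: open_measurable.
      move=> w _; have [wr|wr] := leP r `|Z N w|; [by right|left].
      by apply: rU; rewrite -ball_normE/= sub0r normrN.
    have : (P [set w | (r <= `|Z N w|)%R] <= (2^-1)%:E)%E.
      apply: (@le_trans _ _ (expR (- (1 * N%:R)))%:E).
        by near: N; exact: tailZ.
      (* The tail at rate 1 is at most 1/2, because exp(N) >= 1 + N >= 2. *)
      rewrite lee_fin mul1r expRN lef_pV2 ?posrE ?expR_gt0//.
      apply: le_trans (expR_ge1Dx _).
      by rewrite -[leLHS]/(1 + 1) lerD2l ler1n.
    move=> H1 H2; have := le_trans H2 (leeD2l _ H1).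
    by rewrite -leeBlDr// -EFinB (_ : 1 - 2^-1 = 2^-1 :> R)//; lra.
  rewrite muleC lee_pdivlMr ?ltr0n// -EFinM.
  apply: (@le_trans _ _ (lne (2^-1)%:E)); last first.
    by rewrite lee_lne ?in_itv/= ?leey ?andbT ?lee_fin ?invr_ge0.
  rewrite lne_EFin ?invr_gt0// lee_fin mulNr lerNl -ler_pdivrMl//.
  by near: N; exact: nbhs_infty_ger.
- move=> C cC; have [C0|nC0] := pselect (C 0).
    apply: (@le_trans _ _ 0%E).
      apply: limf_esup_le; near=> N.
      rewrite mule_ge0_le0 ?lee_fin ?invr_ge0// lne_le0 probability_le1//.
      apply: mZB; [near: N; exact: nbhs_infty_gt|exact: closed_measurable].
    rewrite leeNr oppe0; apply: ereal_inf_lbound; exists 0 => //.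
    by rewrite /degenerate_rate eqxx.
  (* The upper limit is shown to lie below every real [K]; to this end the tail hypothesis is
     applied at rate [- K]. *)
  rewrite infy//= (_ : limf_esup _ _ = -oo%E)//; apply: eq_ninfty => K.
  apply: limf_esup_le.
  have [r /= r0 rC] : nbhs_ball (0 : R) (~` C).
    apply/nbhs_ballP; apply: open_nbhs_nbhs; split => //; exact: closed_openC.
  near=> N.
  have N0 : (0 < N)%N by near: N; exact: nbhs_infty_gt.
  have PC : (P (Z N @^-1` C) <= (expR (- (- K * N%:R)))%:E)%E.
    apply: (@le_trans _ _ (P [set w | (r <= `|Z N w|)%R])).
      apply: le_measure; rewrite ?inE; [|exact: mtail|].
        by apply: mZB => //; exact: closed_measurable.
      move=> w CZ /=; rewrite leNgt; apply/negP => rZ.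
      by apply: (rC (Z N w)) => //; rewrite -ball_normE/= sub0r normrN.
    by near: N; exact: tailZ.
  rewrite muleC lee_pdivrMr ?ltr0n// -EFinM.
  apply: (@le_trans _ _ (lne (expR (- (- K * N%:R)))%:E)).
    by rewrite lee_lne ?in_itv/= ?leey ?andbT ?lee_fin ?expR_ge0.
  by rewrite lne_EFin ?expR_gt0// expRK mulNr opprK.
Unshelve. all: by end_near. Qed.

(** * Gaussian tail estimates *)

(* On [V] we have [(x - 0)^2 >= (x - m)^2 + m^2], so the centred density is at
   most [expR (- m^2 / (2 s^2))] times the density with mean [m]. *)
Lemma normal_prob_shift (R : realType) (m s : R) (V : set R) : s != 0 ->
  measurable V -> (forall x, V x -> m ^+ 2 <= m * x) ->
  (normal_prob 0 s V <= (expR (- m ^+ 2 / (s ^+ 2 *+ 2)))%:E)%E.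
Proof.
move=> s0 mV Vm.
apply: (@le_trans _ _
  ((expR (- m ^+ 2 / (s ^+ 2 *+ 2)))%:E * normal_prob m s V)%E).
  rewrite /normal_prob -ge0_integralZl//=; first last.
  - by move=> x _; rewrite lee_fin normal_pdf_ge0.
  - by apply/measurable_funTS/measurable_EFinP; exact: measurable_normal_pdf.
  apply: ge0_le_integral => //=.
  - by move=> x _; rewrite lee_fin normal_pdf_ge0.
  - by apply/measurable_funTS/measurable_EFinP; exact: measurable_normal_pdf.
  - apply/measurable_funTS/measurable_EFinP; apply: measurable_funM => //.
    exact: measurable_normal_pdf.
  - move=> x Vx; rewrite -EFinM lee_fin !normal_pdfE//.
    rewrite mulrCA ler_wpM2l ?normal_peak_ge0// /normal_fun -expRD ler_expR.
    rewrite -mulrDl ler_wpM2r ?invr_ge0 ?mulrn_wge0 ?sqr_ge0//.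
    by have := Vm _ Vx; lra.
rewrite -[leRHS]mule1 lee_wpmul2l ?lee_fin ?expR_ge0//.
exact: (@probability_le1 _ _ _ (@normal_prob R m s)).
Qed.

(** On each of the two half-lines the density is compared with the one centred at the endpoint,
    [- t] or [t]. *)
Lemma normal_prob_tail (R : realType) (s t : R) : s != 0 -> 0 <= t ->
  (normal_prob 0 s [set x | (t <= `|x|)%R] <=
   (2 * expR (- t ^+ 2 / (s ^+ 2 *+ 2)))%:E)%E.
Proof.
move=> s0 t0.
have -> : [set x | (t <= `|x|)%R] = `]-oo, (- t)] `|` `[t, +oo[ :> set R.
  apply/seteqP; split=> x /=; rewrite !in_itv/= ?andbT ler_normr lerNr.
    by case/orP => ->; [right|left].
  by case=> ->; rewrite ?orbT.
apply: (@le_trans _ _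
  (normal_prob 0 s `]-oo, (- t)%R] + normal_prob 0 s `[t, +oo[)%E).
  exact: (@measureU2 _ _ _ (@normal_prob R 0 s)).
rewrite mulr_natl mulr2n EFinD; apply: leeD.
  rewrite -[in leRHS](sqrrN t); apply: normal_prob_shift => // x/=.
  by rewrite in_itv/= => xt; rewrite expr2 ler_wnM2l// oppr_le0.
apply: normal_prob_shift => // x/=.
by rewrite in_itv/= andbT => xt; rewrite expr2 ler_wpM2l.
Qed.

(** * Two-by-two matrices and the area form *)

Lemma mulmx_col2 (R : realType) (A : 'M[R]_2) (z : 'cV[R]_2) i :
  (A *m z) i 0 = A i 0 * z 0 0 + A i 1 * z 1 0.
Proof.
by rewrite mxE !big_ord_recl big_ord0 addr0; congr (_ * _ + A i _ * z _ _);
  apply/val_inj.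
Qed.

Lemma mxtrace2 (R : realType) (A : 'M[R]_2) : \tr A = A 0 0 + A 1 1.
Proof.
rewrite /mxtrace !big_ord_recl big_ord0 addr0; congr (_ + A _ _); exact/val_inj.
Qed.

Lemma det_mx2 (R : realType) (A : 'M[R]_2) :
  \det A = A 0 0 * A 1 1 - A 0 1 * A 1 0.
Proof.
rewrite (expand_det_row _ 0) !big_ord_recl big_ord0 addr0.
rewrite /cofactor !det_mx11 !mxE/=.
rewrite expr0 expr1 !mul1r mulN1r mulrN.
by congr (A _ _ * A _ _ - A _ _ * A _ _); apply/val_inj.
Qed.

(** The differential of an affine function is its linear part, so the constants drop out and the
    determinant of the linear part remains. *)
Lemma wedge_affine (R : realType) (a00 a01 a10 a11 c0 c1 : R)
    (p u v : 'cV[R]_2) :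
  wedge (fun z : 'cV[R]_2 => a00 * z 0 0 + a01 * z 1 0 + c0)
        (fun z : 'cV[R]_2 => a10 * z 0 0 + a11 * z 1 0 + c1) p u v =
  (a00 * a11 - a01 * a10) * (u 0 0 * v 1 0 - u 1 0 * v 0 0).
Proof.
have dif (a b c : R) (w : 'cV[R]_2) :
    'd (fun z : 'cV[R]_2 => a * z 0 0 + b * z 1 0 + c) p w =
    a * w 0 0 + b * w 1 0.
  pose f (z : 'cV[R]_2) : R^o := a * z 0 0 + b * z 1 0.
  have lf : linear f.
    by move=> k x y; rewrite /f !mxE scalerDr /GRing.scale/=; ring.
  pose fM := GRing.isLinear.Build _ _ _ _ _ lf.
  pose fL : {linear 'cV[R]_2 -> R^o} := HB.pack f fM.
  have cf : continuous fL.
    move=> x.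
    have cx i : ((z : 'cV[R]_2) i 0 @[z --> x] --> x i 0).
      exact: coord_continuous.
    exact: (@cvgD _ R^o _ _ _ _ _ _ _ (@cvgMl_tmp _ _ _ _ _ a _ (cx 0))
      (@cvgMl_tmp _ _ _ _ _ b _ (cx 1))).
  have df : differentiable fL p by exact: linear_differentiable.
  rewrite (_ : (fun z => _) = ((fL : 'cV[R]_2 -> R^o) + cst c)); last first.
    exact/funext.
  by rewrite diffD// diff_cst (diff_lin _ cf) /= addr0.
by rewrite /wedge !dif; ring.
Qed.

(** * The Lyapunov function and the bound on the numerical solution *)

(** Completing the square: [- 4 * a01 * Q x y] equals the discriminant of (A1) times [x ^+ 2] plus
    the square of [(a11 - a00) * x - 2 * a01 * y]. The factor [s = - 4 * a01] thus corrects the sign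
    of [Q], and [K] is the inverse discriminant. *)
Lemma invariant_form (R : realType) (a00 a01 a10 a11 : R) :
  let D := a00 * a11 - a01 * a10 in
  let Q x y := x * (a10 * x + a11 * y) - y * (a00 * x + a01 * y) in
  0 < 4 * D - (a00 + a11) ^+ 2 ->
  exists s K, [/\ 0 < K, forall x y, x ^+ 2 <= K * (s * Q x y)
                & forall x y, 0 <= s * Q x y].
Proof.
move=> D Q hD.
have K0 : 0 < (4 * D - (a00 + a11) ^+ 2)^-1 by rewrite invr_gt0.
have QE x y : x ^+ 2 <= (4 * D - (a00 + a11) ^+ 2)^-1 * ((- 4 * a01) * Q x y).
  rewrite -ler_pdivrMl ?invrK// -subr_ge0.
  rewrite [leRHS](_ : _ = ((a11 - a00) * x - 2 * a01 * y) ^+ 2) ?sqr_ge0//.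
  by rewrite /Q /D; ring.
exists (- 4 * a01), (4 * D - (a00 + a11) ^+ 2)^-1; split => //.
move=> x y; rewrite -(pmulr_rge0 _ K0); apply: le_trans (QE x y).
exact: sqr_ge0.
Qed.

(* Expand [0 <= s * Q (e x - u) (e y - v) / e]. *)
Lemma lyapunov_add (R : realType) (a00 a01 a10 a11 s e : R) :
  let Q x y := x * (a10 * x + a11 * y) - y * (a00 * x + a01 * y) in
  (forall x y, 0 <= s * Q x y) -> 0 < e -> forall x y u v,
  s * Q (x + u) (y + v) <= (1 + e) * (s * Q x y) + (1 + e^-1) * (s * Q u v).
Proof.
move=> Q Qge0 e0 x y u v.
have ie0 : 0 <= e^-1 by rewrite invr_ge0 ltW.
have := mulr_ge0 ie0 (Qge0 (e * x - u) (e * y - v)).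
move=> /le_trans H; rewrite -subr_ge0; apply: H; rewrite le_eqVlt.
by apply/orP; left; apply/eqP; rewrite /Q; field; rewrite gt_eqF.
Qed.

(** [V] contracts by [D < 1] under [A], so bounded noise keeps it bounded uniformly in [n]. The
    constant is chosen before the path, [n] and [M], which lets [M] grow with [n] later. *)
Lemma numerical_solution_bound (R : realType) (alpha h : R) (A : 'M[R]_2)
    (b z : 'cV[R]_2) :
  0 < 4 * \det A - (\tr A) ^+ 2 -> 0 < \det A < 1 ->
  exists2 K, 0 < K & forall (Omega : Type) (W : R -> Omega -> R) n w M,
    (forall k, (k < n)%N -> `|W (k.+1%:R * h) w - W (k%:R * h) w| <= M) ->
    (numerical_solution W alpha A b h n w z 0 0) ^+ 2 <= K * (1 + M ^+ 2).
Proof.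
rewrite det_mx2 mxtrace2 => hdisc /andP[D0 D1].
have [s [K0 [K0_gt0 leQ Q_ge0]]] := invariant_form hdisc.
pose Q x y := x * (A 1 0 * x + A 1 1 * y) - y * (A 0 0 * x + A 0 1 * y).
pose V (u : 'cV[R]_2) := s * Q (u 0 0) (u 1 0).
have V_ge0 u : 0 <= V u by exact: Q_ge0.
set D := A 0 0 * A 1 1 - A 0 1 * A 1 0 in D0 D1.
have VA u : V (A *m u) = D * V u by rewrite /V !mulmx_col2 /Q /D; ring.
have VZ c u : V (c *: u) = c ^+ 2 * V u by rewrite /V !mxE /Q; ring.
(* This [e] makes [(1 + e) * D = (1 + D) / 2], still below 1. *)
pose e := (1 - D) / (2 * D).
have e0 : 0 < e by rewrite divr_gt0 ?subr_gt0// mulr_gt0.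
have VD u v : V (u + v) <= (1 + e) * V u + (1 + e^-1) * V v.
  by rewrite /V !mxE; exact: lyapunov_add.
pose C := (1 + e^-1) * (alpha ^+ 2 * V b).
have C_ge0 : 0 <= C.
  apply: mulr_ge0; last exact: mulr_ge0 (sqr_ge0 _) (V_ge0 _).
  by rewrite addr_ge0// invr_ge0 ltW.
(* [G] solves [(1 + D) / 2 * G + C = G], so that the bound [V z + G * M ^+ 2] passes from one step
   to the next. *)
pose G := 2 * C / (1 - D).
have G_ge0 : 0 <= G by apply: divr_ge0; [exact: mulr_ge0|rewrite subr_ge0 ltW].
exists (K0 * (V z + G) + 1).
  by rewrite ltr_pwDr// mulr_ge0 ?addr_ge0// ltW.
move=> Omega W n w M hM.
have bound : V (numerical_solution W alpha A b h n w z) <= V z + G * M ^+ 2.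
  elim: n hM => [_|n IH hM] /=; first by rewrite lerDl mulr_ge0 ?sqr_ge0.
  have {IH} IH := IH (fun k kn => hM k (ltnW kn)).
  apply: (le_trans (VD _ _)); rewrite VA VZ.
  set v := V _ in IH *.
  have dW : (alpha * (W (n.+1%:R * h) w - W (n%:R * h) w)) ^+ 2 <=
      alpha ^+ 2 * M ^+ 2.
    rewrite exprMn ler_wpM2l ?sqr_ge0// -[leLHS]real_normK ?num_real//.
    rewrite lerXn2r ?nnegrE//; last exact: hM.
    (* [0 <= M] is not assumed; it follows from the bound on increment [n]. *)
    exact: le_trans (normr_ge0 _) (hM _ (ltnSn n)).
  apply: (@le_trans _ _ ((1 + D) / 2 * (V z + G * M ^+ 2) + C * M ^+ 2)).
    apply: lerD.
      rewrite mulrA (_ : (1 + e) * D = (1 + D) / 2); last first.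
        by rewrite /e; field; rewrite gt_eqF.
      by rewrite ler_wpM2l// divr_ge0// addr_ge0// ltW.
    rewrite /C -mulrA.
    rewrite [leRHS](_ : _ = (1 + e^-1) * (alpha ^+ 2 * M ^+ 2 * V b)).
      2: by ring.
    by rewrite ler_wpM2l ?ler_wpM2r// addr_ge0// invr_ge0 ltW.
  have -> : C = G * (1 - D) / 2.
    by rewrite /G; field; rewrite gt_eqF// subr_gt0.
  have := V_ge0 z; nra.
apply: (le_trans (leQ _ (numerical_solution W alpha A b h n w z 1 0))).
apply: (@le_trans _ _ (K0 * (V z + G * M ^+ 2))).
  by rewrite ler_wpM2l// ltW.
have KG : 0 <= K0 * G by rewrite mulr_ge0// ltW.
have KV : 0 <= K0 * V z by rewrite mulr_ge0// ltW.
have := sqr_ge0 M; nra.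
Qed.

(** * Superexponential tails of the discrete mean velocity *)

Lemma brownian_measurable (R : realType) (d : measure_display)
    (Omega : measurableType d) (P : probability Omega R)
    (F : R -> set (set Omega)) (W : R -> Omega -> R) (t : R) :
  complete_filtration P F -> brownian_motion P F W ->
  0 <= t -> measurable_fun [set: Omega] (W t).
Proof.
move=> [_ FS _ _] [adW _ _ _ _] t0 _ B mB.
by rewrite setTI; apply: (FS t t0); exact: adW.
Qed.

Lemma measurable_numerical_solution (R : realType) (d : measure_display)
    (Omega : measurableType d) (P : probability Omega R)
    (F : R -> set (set Omega)) (W : R -> Omega -> R)
    (alpha h : R) (A : 'M[R]_2) (b z : 'cV[R]_2) (n : nat) (i : 'I_2) :
  complete_filtration P F -> brownian_motion P F W ->
  0 <= h ->
  measurable_fun [set: Omega]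
    (fun w => numerical_solution W alpha A b h n w z i 0).
Proof.
move=> hF hW h0; elim: n i => [|n IH] i /=; first exact: measurable_cst.
under eq_fun do rewrite mxE mulmx_col2 [(_ *: b) i 0]mxE.
have mW k : measurable_fun [set: Omega] (W (k%:R * h)).
  by apply: (brownian_measurable hF hW); rewrite mulr_ge0.
apply: measurable_funD.
  by apply: measurable_funD; apply: measurable_funM => //; exact: IH.
by do 2!apply: measurable_funM => //; exact: measurable_funB.
Qed.

Lemma discrete_mean_velocity_tail (R : realType) (d : measure_display)
    (Omega : measurableType d) (P : probability Omega R)
    (F : R -> set (set Omega)) (W : R -> Omega -> R)
    (alpha x0 y0 h : R) (A : 'M[R]_2) (b : 'cV[R]_2) (e K : R) :
  complete_filtration P F -> brownian_motion P F W ->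
  0 < h -> 0 < 4 * \det A - (\tr A) ^+ 2 -> 0 < \det A < 1 -> 0 < e ->
  \forall N \near \oo,
    (P [set w | (e <= `|discrete_mean_velocity W alpha x0 y0 A b h N w|)%R]
      <= (expR (- (K * N%:R)))%:E)%E.
Proof.
move=> hF hW h0 hdisc hdet e0.
have [K1 K10 hK1] :=
  numerical_solution_bound alpha h b (initial_state x0 y0) hdisc hdet.
(* With [c ^+ 2 = q / K1], increments bounded by [c * N] give x_N^2 <= K1 + q N^2, which is less
   than 2 q N^2 = (e N h)^2 as soon as q N > K1. *)
pose q := (h * e) ^+ 2 / 2.
have q0 : 0 < q by rewrite divr_gt0// exprn_gt0// mulr_gt0.
pose c := Num.sqrt (q / K1).
have c2 : c ^+ 2 = q / K1 by rewrite sqr_sqrtr// divr_ge0// ltW.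
have c0 : 0 < c by rewrite sqrtr_gt0 divr_gt0.
have [_ _ _ lawW _] := hW.
pose incr k w := W (k.+1%:R * h) w - W (k%:R * h) w.
pose far N k := incr k @^-1` [set x | c * N%:R <= `|x|].
have mfar0 N : measurable [set x : R | c * N%:R <= `|x|].
  exact: (@measurable_normr_ge _ _ _ id).
have mW k : measurable_fun [set: Omega] (W (k%:R * h)).
  by apply: (brownian_measurable hF hW); rewrite mulr_ge0// ltW.
have mfar N k : measurable (far N k).
  by rewrite /far -[X in measurable X]setTI; apply: measurable_funB.
near=> N.
have N0 : (0 < N)%N by near: N; exact: nbhs_infty_gt.
have N1 : 1 <= N%:R :> R by rewrite ler1n.
have sub : [set w | e <= `|discrete_mean_velocity W alpha x0 y0 A b h N w|]
    `<=` \big[setU/set0]_(k < N) far N k.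
  (* By contraposition: if no increment is far, the bound on the numerical solution contradicts
     [ew]. *)
  move=> w /= ew; rewrite -bigcup_mkord; apply: contrapT => nfar.
  have near_incr k : (k < N)%N -> `|incr k w| <= c * N%:R.
    move=> kN; rewrite leNgt; apply/negP => lt_incr; apply: nfar.
    by exists k => //; exact: ltW.
  have := hK1 _ _ _ _ _ near_incr; rewrite leNgt => /negP; apply.
  move: ew; rewrite /discrete_mean_velocity.
  set x := numerical_solution _ _ _ _ _ _ _ _ _ _.
  have Nh0 : 0 < N%:R * h by rewrite mulr_gt0 ?ltr0n.
  rewrite normrM normfV (gtr0_norm Nh0) ler_pdivlMr// => ex.
  rewrite -(real_normK (num_real x)).
  apply: (@lt_le_trans _ _ ((e * (N%:R * h)) ^+ 2)); last first.
    by rewrite lerXn2r// nnegrE ltW// mulr_gt0.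
  have -> : (e * (N%:R * h)) ^+ 2 = 2 * q * N%:R ^+ 2 by rewrite /q; field.
  rewrite mulrDr mulr1 exprMn c2 mulrA (mulrC K1) divfK ?gt_eqF//.
  rewrite -mulrA mulr_natl mulr2n ltrD2r.
  apply: (@lt_le_trans _ _ (q * N%:R)); last first.
    by rewrite ler_wpM2l ?(ltW q0)// expr2 ler_peMl.
  by rewrite -ltr_pdivrMl//; near: N; exact: nbhs_infty_gtr.
have Pfar k : (P (far N k) <= (2 * expR (- (c * N%:R) ^+ 2 / (h *+ 2)))%:E)%E.
  have kh : k.+1%:R * h - k%:R * h = h by rewrite -mulrBl -natrB// subSnn mul1r.
  rewrite /far lawW//; last 2 first.
  - by rewrite mulr_ge0// ltW.
  - by rewrite -subr_gt0 kh.
  rewrite kh; apply: le_trans (normal_prob_tail _ _) _.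
  - by rewrite gt_eqF// sqrtr_gt0.
  - by rewrite mulr_ge0// ltW.
  by rewrite sqr_sqrtr// ltW.
apply: (@le_trans _ _ (\sum_(k < N) P (far N k))%E).
  apply: content_subadditive => //.
  apply: measurable_normr_ge; apply: measurable_funM => //.
  exact: measurable_numerical_solution hF hW (ltW h0).
apply: (@le_trans _ _
  (\sum_(k < N) (2 * expR (- (c * N%:R) ^+ 2 / (h *+ 2)))%:E)%E).
  by apply: lee_sum => k _; exact: Pfar.
rewrite sumEFin sumr_const card_ord lee_fin -[_ *+ N]mulr_natl.
(* The union bound's factor 2 N is absorbed into exp(2 N). *)
apply: (@le_trans _ _ (expR (2 * N%:R) * expR (- (c * N%:R) ^+ 2 / (h *+ 2)))).
  rewrite mulrA ler_wpM2r ?expR_ge0//.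
  by apply: le_trans (expR_ge1Dx _); rewrite mulrC lerDr.
rewrite -expRD ler_expR.
(* The Gaussian exponent is quadratic in [N], so it eventually beats the linear term [K * N]
   together with the absorbed 2 N. *)
have : (K + 2) * N%:R <= c ^+ 2 / (h *+ 2) * N%:R * N%:R.
  rewrite ler_wpM2r// -ler_pdivrMl.
    by near: N; exact: nbhs_infty_ger.
  by rewrite divr_gt0 ?exprn_gt0// mulrn_wgt0.
rewrite mulNr exprMn.
have -> : c ^+ 2 / (h *+ 2) * N%:R * N%:R =
  c ^+ 2 * N%:R ^+ 2 / (h *+ 2) by ring.
lra.
Unshelve. all: by end_near. Qed.

(** * Non-symplecticity and failure of asymptotic preservation *)

(** The first step already fails: on the basis vectors the area form is 1 for the initial data and
    [\det A] after one step. *)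
Lemma not_symplectic_of_det d (Omega : measurableType d) (R : realType)
    (P : probability Omega R) (W : R -> Omega -> R) (alpha : R)
    (A : 'M[R]_2) (b : 'cV[R]_2) (h : R) :
  \det A != 1 -> ~ symplectic_method P W alpha A b h.
Proof.
move=> detA /(_ 0%N)[N [mN PN0 subN]].
(* A null set cannot be all of [Omega], so the almost sure identity holds at some [w]. *)
have [w Nw] : exists w, ~ N w.
  apply: contrapT => allN; have := @probability_setT _ _ _ P.
  suff -> : setT = N by rewrite PN0 => /esym/eqP; rewrite onee_eq0.
  apply/esym/seteqP; split => // w _; apply: contrapT => Nw; apply: allN.
  by exists w.
have := contrapT (fun neq => Nw (subN w neq)).
move=> /(_ 0 (delta_mx 0 0) (delta_mx 1 0)).
set c := alpha * (W (1%:R * h) w - W (0%:R * h) w).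
have step i : (fun z => numerical_solution W alpha A b h 1 w z i 0) =
    (fun z : 'cV[R]_2 => A i 0 * z 0 0 + A i 1 * z 1 0 + c * b i 0).
  by apply/funext => z; rewrite /= mxE mulmx_col2 [(_ *: b) i 0]mxE.
rewrite (step 0) (step 1) wedge_affine.
have -> : (fun z => numerical_solution W alpha A b h 0 w z 0 0) =
    (fun z : 'cV[R]_2 => 1 * z 0 0 + 0 * z 1 0 + 0).
  by apply/funext => z /=; ring.
have -> : (fun z => numerical_solution W alpha A b h 0 w z 1 0) =
    (fun z : 'cV[R]_2 => 0 * z 0 0 + 1 * z 1 0 + 0).
  by apply/funext => z /=; ring.
rewrite wedge_affine !mxE/= -det_mx2.
by rewrite !(mulr1, mulr0, mul0r, subr0) => /eqP; exact/negP.
Qed.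

(** Any rate function of the same family is [+oo] at [y], since the ball of radius [|y| / 2] around
    [y] misses 0. The modified rate is therefore eventually constant in [h]. *)
Lemma degenerate_modified_rate d (Omega : measurableType d) (R : realType)
    (P : probability Omega R) (Z : R -> nat -> Omega -> R)
    (Jh : R -> R -> \bar R) (y : R) : y != 0 ->
  (\forall h \near 0^'+, discrete_ldp P (Z h) (@degenerate_rate R)) ->
  (\forall h \near 0^'+, discrete_ldp P (Z h) (Jh h)) ->
  modified_rate h (Jh h) y @[h --> 0^'+] --> +oo%E.
Proof.
move=> y0 degZ ldpZ; apply: cvg_near_cst; near=> h.
have h0 : 0 < h by near: h; exact: nbhs_right_gt.
rewrite /modified_rate.
suff -> : Jh h y = +oo%E by rewrite gt0_mulye// lte_fin invr_gt0.
have degZh : discrete_ldp P (Z h) (@degenerate_rate R) by near: h.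
have ldpZh : discrete_ldp P (Z h) (Jh h) by near: h.
apply: (ldp_rate_pinfty (e := `|y| / 2) _ degZh ldpZh).
- by near=> N; split; [near: N; exact: nbhs_infty_gt|].
- by rewrite divr_gt0// normr_gt0.
- move=> z yz; rewrite /degenerate_rate; case: eqVneq => // z0; exfalso.
  have : 0 < `|y| by rewrite normr_gt0.
  by move: yz; rewrite z0 subr0; lra.
Unshelve. all: by end_near. Qed.

Unset Implicit Arguments.

Theorem theorem5p4 (R : realType) (d : measure_display)
    (Omega : measurableType d) (P : probability Omega R)
    (F : R -> set (set Omega)) (W : R -> Omega -> R)
    (hF : complete_filtration P F) (hW : brownian_motion P F W)
    (alpha x0 y0 : R) (halpha : 0 < alpha)
    (A : R -> 'M[R]_2) (b : R -> 'cV[R]_2)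
    (hb : forall h, 0 < h -> b h 0 0 ^+ 2 + b h 1 0 ^+ 2 != 0) :
  let B h := discrete_mean_velocity W alpha x0 y0 (A h) (b h) h in
  (forall h, 0 < h ->
     4 * \det (A h) - (\tr (A h)) ^+ 2 > 0 -> 0 < \det (A h) < 1 ->
     ~ symplectic_method P W alpha (A h) (b h) h /\
     (discrete_ldp P (B h) (@degenerate_rate R) /\
      good_rate_function (@degenerate_rate R))) /\
  ((\forall h \near 0^'+,
      4 * \det (A h) - (\tr (A h)) ^+ 2 > 0 /\ 0 < \det (A h) < 1) ->
     (forall Jh : R -> R -> \bar R,
        (\forall h \near 0^'+, discrete_ldp P (B h) (Jh h)) ->
        forall y : R, y != 0 ->
          exists2 l : \bar R,
            modified_rate h (Jh h) y @[h --> 0^'+] --> l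
            & l <> oscillator_rate alpha y) /\
     (forall X Y : R -> Omega -> R,
        oscillator_solution P F W alpha x0 y0 X Y ->
        continuous_ldp P (mean_velocity X) (oscillator_rate alpha) ->
        ~ asymptotically_preserves_ldp P (mean_velocity X) B)).
Proof.
move=> B.
have ldpB h : 0 < h -> 4 * \det (A h) - (\tr (A h)) ^+ 2 > 0 ->
    0 < \det (A h) < 1 -> discrete_ldp P (B h) (@degenerate_rate R).
  move=> h0 hdisc hdet; apply: discrete_ldp_degenerate => [N _|e K e0].
    apply: measurable_funM => //.
    exact: (measurable_numerical_solution _ _ _ _ _ _ hF hW (ltW h0)).
  exact: (discrete_mean_velocity_tail _ _ _ _ _ hF hW).
split=> [h h0 hdisc hdet|hA].
  split; last by split; [exact: ldpB|exact: good_degenerate_rate].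
  apply: not_symplectic_of_det.
  by move/andP: hdet => [_]; rewrite lt_neqAle => /andP[].
have degB : \forall h \near 0^'+, discrete_ldp P (B h) (@degenerate_rate R).
  near=> h.
  have [hdisc hdet] :
      4 * \det (A h) - (\tr (A h)) ^+ 2 > 0 /\ 0 < \det (A h) < 1 by near: h.
  by apply: ldpB => //; near: h; exact: nbhs_right_gt.
split=> [Jh ldpJh y yN0|X Y _ oscX [J [Jh [ldpJ ldpJh cvgJh]]]].
  by exists +oo%E => //; exact: degenerate_modified_rate degB ldpJh.
(* Preservation makes [J y] a limit of modified rates, and these tend to [+oo]. *)
have Jy y : y != 0 -> J y = +oo%E.
  move=> yN0; apply: cvg_unique (cvgJh y) _ => //.
  exact: degenerate_modified_rate degB ldpJh.
(* The contradiction is taken at the point 1: [J] is [+oo] on the ball of radius 1/2 there, and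
   comparing the two principles for [mean_velocity X] would make the finite value
   [oscillator_rate alpha 1] infinite. *)
suff : oscillator_rate alpha 1 = +oo%E by [].
apply: (ldp_rate_pinfty (e := 2^-1) _ ldpJ oscX) => //.
- near=> T; have T0 : 0 < T by near: T; exact: nbhs_pinfty_gt.
  by split => //; exact: ltW.
- move=> z z1; apply: Jy; apply/eqP => z0.
  by move: z1; rewrite z0 subr0 normr1; lra.
Unshelve. all: by end_near. Qed.
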